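(* Let $G$ be a unicyclic graph, different from a cycle, whose unique cycle $C_t$ has $t\ge 3$ vertices. If $G$ has exactly one end-vertex (i.e. $|\tau(G)|=1$), then $pd_s(G)=3$.
   Context: Graphs are finite, simple, connected; $d_G$ is shortest-path distance, $d_G(x,W)=\min\{d_G(x,w):w\in W\}$. A set $W$ strongly resolves different vertices $x,y\notin W$ if $d_G(x,W)=d_G(x,y)+d_G(y,W)$ or $d_G(y,W)=d_G(y,x)+d_G(x,W)$. A vertex partition $\Pi$ is a strong resolving partition if every two different vertices in the same set of $\Pi$ are strongly resolved by some set of $\Pi$; $pd_s(G)$ is the minimum cardinality of such a partition. $\tau(G)$ denotes the set of end-vertices (vertices of degree one) of $G$. *)

(* Defs.v *)
From HB Require Import structures.
From mathcomp Require Import all_boot.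
Set Implicit Arguments.
Unset Strict Implicit.
Unset Printing Implicit Defensive.

Record graph := Graph {
  vertex :> finType;
  adj : rel vertex;
  adj_sym : symmetric adj;
  adj_irrefl : irreflexive adj;
  adj_connected : forall x y, connect adj x y
}.

Section Graph.
Variable G : graph.
Implicit Types (x y : G) (W : {set G}) (P : {set {set G}}) (c : seq G).

(* A walk of length n from x to y; the vertices of the n-tuple are those
   visited after x. *)
Definition walk x y (n : nat) : bool :=
  [exists p : n.-tuple G, path (@adj G) x p && (last x p == y)].

Lemma walk_ex x y : exists n, walk x y n.
Proof.
have /connectP[p ep ->] := adj_connected x y.
by exists (size p); apply/existsP; exists (in_tuple p); rewrite ep eqxx.
Qed.

Definition dist x y : nat := ex_minn (walk_ex x y).

Lemma dist_self x : dist x x = 0.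
Proof.
rewrite /dist; case: ex_minnP => n _ /(_ 0) le0; apply/eqP.
by rewrite -leqn0 le0 //; apply/existsP; exists [tuple]; rewrite /= eqxx.
Qed.

Lemma dist_lt_card x y : dist x y < #|G|.
Proof.
rewrite /dist; case: ex_minnP => n _ min_n.
have /connectP[p0 ep0 def_y] := adj_connected x y.
case/shortenP: ep0 def_y => p ep Up _ def_y.
apply: leq_ltn_trans (min_n (size p) _) _.
  by apply/existsP; exists (in_tuple p); rewrite ep def_y eqxx.
by have := max_card (mem (x :: p)); rewrite (card_uniqP Up).
Qed.

(* The default value #|G| exceeds every distance (dist_lt_card), so for
   nonempty W this is the minimum of the distances to vertices of W. *)
Definition dist_set x W : nat := \big[minn/#|G|]_(w in W) dist x w.

Definition strongly_resolves W x y : bool :=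
  [&& x != y, x \notin W, y \notin W &
      (dist_set x W == dist x y + dist_set y W)
   || (dist_set y W == dist y x + dist_set x W)].

Definition strong_resolving_partition P : bool :=
  partition P [set: G] &&
  [forall A in P, forall x in A, forall y in A,
     (x != y) ==> [exists W in P, strongly_resolves W x y]].

Lemma strong_resolving_partition_ex :
  exists n, [exists P, strong_resolving_partition P && (#|P| == n)].
Proof.
pose P0 : {set {set G}} := [set [set x] | x in [set: G]].
exists #|P0|; apply/existsP; exists P0; rewrite eqxx andbT.
apply/andP; split.
  apply/and3P; split.
  - apply/eqP/setP=> x; rewrite inE; apply/bigcupP.
    by exists [set x]; rewrite ?set11 // imset_f.
  - apply/trivIsetP=> _ _ /imsetP[x _ ->] /imsetP[y _ ->] ne_xy.
    by rewrite disjoints1 inE; apply: contraNneq ne_xy => ->.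
  - by apply/imsetP=> -[x _ /setP/(_ x)]; rewrite !inE eqxx.
apply/forall_inP=> _ /imsetP[z _ ->].
apply/forall_inP=> x /set1P->; apply/forall_inP=> y /set1P->.
by rewrite eqxx.
Qed.

Definition pds : nat := ex_minn strong_resolving_partition_ex.

Definition end_vertices : {set G} := [set x | #|[set y | adj x y]| == 1].

(* A cycle of G is listed as the cyclic sequence of its (distinct) vertices.
   A single cycle has several such listings (rotations, reversals), so
   uniqueness of the cycle is uniqueness of its edge set. *)
Definition graph_cycle c : bool := ucycleb (@adj G) c && (3 <= size c).

Definition cycle_edges c : {set {set G}} := [set [set x; next c x] | x in c].

Definition unicyclic : Prop :=
  exists2 c, graph_cycle c &
    forall c', graph_cycle c' -> cycle_edges c' = cycle_edges c.

Definition is_cycle_graph : Prop :=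
  exists c, [/\ graph_cycle c, forall x, x \in c
    & forall x y, adj x y = ([set x; y] \in cycle_edges c)].

End Graph.

Arguments pds : clear implicits.
Arguments end_vertices : clear implicits.
Arguments unicyclic : clear implicits.
Arguments is_cycle_graph : clear implicits.

(* Main.v *)
(**
  Lower bound: if only two sets A and B resolve each other, then vertices of A
  have distinct distances to B and vice versa. Placing A by increasing distance
  to B on one side of the integers and B by increasing distance to A on the
  other gives an injective labelling in which adjacent vertices have consecutive
  labels; the vertex of largest label on a cycle would then have two neighbours
  with the same label.

  Upper bound: every edge off the unique cycle is a bridge. Let v be the only
  end-vertex and D the distance to v. A vertex off the cycle has a neighbour
  farther from v (otherwise it would be an end-vertex), so it is joined to the
  cycle through vertices with larger D, and to v through vertices with smaller
  D. Two such vertices at equal distance from v would put an edge off the cycle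
  on a second cycle; hence D is injective off the cycle, and only one cycle
  vertex c0 has neighbours off the cycle. The three classes are the tail
  together with c0, and the two arcs of the cycle minus c0: the arcs are
  resolved by the tail, the tail by the first arc.
*)
Require Import Defs.
From HB Require Import structures.
From mathcomp Require Import all_boot.
From mathcomp Require Import zify.

Set Implicit Arguments.
Unset Strict Implicit.
Unset Printing Implicit Defensive.

HB.instance Definition _ := SemiGroup.isComLaw.Build nat minn minnA minnC.

(** * Geodesics and distances to sets *)

Section Distance.
Variable G : graph.
Implicit Types (x y z : G) (W : {set G}).

Lemma dist_le_size x p : path (@adj G) x p -> dist x (last x p) <= size p.
Proof.
move=> xp; rewrite /dist; case: ex_minnP => n _; apply.
by apply/existsP; exists (in_tuple p); rewrite xp eqxx.
Qed.

Lemma geodesicP x y :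
  exists p, [/\ path (@adj G) x p, last x p = y & size p = dist x y].
Proof.
rewrite /dist; case: ex_minnP => n /existsP[p /andP[xp /eqP px]] _.
by exists p; rewrite size_tuple.
Qed.

Lemma dist_eq0 x y : (dist x y == 0) = (x == y).
Proof.
apply/idP/eqP => [/eqP d0 | ->]; last by rewrite dist_self.
have [p [_ def_y sp]] := geodesicP x y.
by rewrite -def_y; move: sp; rewrite d0 => /size0nil->.
Qed.

Lemma dist_adjl x y z : adj x y -> dist x z <= (dist y z).+1.
Proof.
move=> xy; have [p [yp <- <-]] := geodesicP y z.
by apply: (@dist_le_size x (y :: p)); rewrite /= xy.
Qed.

Lemma dist_adjr x y z : adj y z -> dist x z <= (dist x y).+1.
Proof.
move=> yz; have [p [xp lp <-]] := geodesicP x y.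
have := @dist_le_size x (rcons p z).
by rewrite rcons_path xp lp yz last_rcons size_rcons; apply.
Qed.

Lemma dist_adj x y : adj x y -> dist x y = 1.
Proof.
move=> xy; apply/eqP; rewrite eqn_leq lt0n dist_eq0.
apply/andP; split; first by have := dist_adjr x xy; rewrite dist_self.
by apply: contraTneq xy => ->; rewrite adj_irrefl.
Qed.

Lemma dist_parent x y :
  0 < dist x y -> exists2 u, adj y u & (dist x u).+1 = dist x y.
Proof.
have [p [xp lp sp]] := geodesicP x y; rewrite -sp.
case/lastP: p xp lp sp => // p z; rewrite rcons_path last_rcons size_rcons.
move=> /andP[xp pz] <- sp _; exists (last x p); first by rewrite adj_sym.
apply/eqP; rewrite eqn_leq ltnS dist_le_size //= sp.
exact: dist_adjr.
Qed.

Lemma dist_set_le x w W : w \in W -> dist_set x W <= dist x w.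
Proof.
move=> Ww; rewrite /dist_set (big_rem_AC _ _ _ _ (mem_index_enum w)).
by rewrite Ww geq_minl.
Qed.

Lemma dist_set_leq_card x W : dist_set x W <= #|G|.
Proof.
rewrite /dist_set; elim/big_rec: _ => // w m _ le_m.
by rewrite geq_min le_m orbT.
Qed.

(** The bound [n <= #|G|] covers the default value, taken when [W] is empty. *)
Lemma dist_set_geq n x W :
  n <= #|G| -> (forall w, w \in W -> n <= dist x w) -> n <= dist_set x W.
Proof.
move=> n_le n_leW; rewrite /dist_set; elim/big_rec: _ => // w m Ww le_m.
by rewrite leq_min le_m n_leW.
Qed.

Lemma dist_set_gt0 x W : x \notin W -> 0 < dist_set x W.
Proof.
move=> xW; apply: dist_set_geq => [|w Ww].
  by apply: leq_ltn_trans (dist_lt_card x x).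
by rewrite lt0n dist_eq0; apply: contraNneq xW => ->.
Qed.

(* [h] will be the distance to [W] on [X]: it is a lower bound because it is
   1-Lipschitz and vanishes on [W], and an upper bound because every vertex of
   [X] can step to height one less without leaving [X :|: W]. *)
Section Lipschitz.
Variable h : G -> nat.
Hypothesis h_adj : forall x y, adj x y -> h x <= (h y).+1.

Lemma lipschitz_dist x y : h x <= h y + dist x y.
Proof.
have [p [xp <- <-]] := geodesicP x y.
elim: p x xp => [|z p IHp] x /=; first by rewrite addn0.
by move=> /andP[/h_adj hx /IHp]; lia.
Qed.

Variables X W : {set G}.
Hypothesis hW : forall x, x \in W -> h x = 0.
Hypothesis hX : forall x, x \in X -> 0 < h x.
Hypothesis h_inj : {in X &, injective h}.
Hypothesis h_step : forall x, x \in X ->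
  exists2 y, adj x y & (y \in X :|: W) && ((h y).+1 == h x).

(** Steps of height one less lead from [x] down to the height of [y]; that height being positive,
    they stay in [X], and injectivity makes the vertex reached equal to [y]. *)
Lemma lipschitz_dist_eq x y :
  x \in X -> y \in X -> h y <= h x -> h x = dist x y + h y.
Proof.
move=> Xx Xy le_yx; apply/eqP; rewrite eqn_leq addnC lipschitz_dist /=.
move: {2}(h x - h y) (erefl (h x - h y)) => n.
elim: n x Xx le_yx => [|n IHn] x Xx le_yx def_n.
  have -> : x = y by apply: h_inj => //; lia.
  by rewrite dist_self addn0.
have [z xz /andP[/setUP[Xz | /hW hz] /eqP hxz]] := h_step Xx; last first.
  by have := hX Xy; lia.
have := dist_adjl y xz; have := IHn z Xz; lia.
Qed.

Lemma lipschitz_dist_set x : x \in X -> dist_set x W = h x.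
Proof.
move=> Xx.
have [w Ww dw] : exists2 w, w \in W & dist x w <= h x.
  move: {2}(h x) (leqnn (h x)) => n.
  elim: n x Xx => [|n IHn] x Xx le_n; first by have := hX Xx; lia.
  have [z xz /andP[/setUP[Xz | Wz] /eqP hxz]] := h_step Xx.
    have [|w Ww dw] := IHn z Xz; first by lia.
    by exists w => //; have := dist_adjl w xz; lia.
  by exists z => //; rewrite (dist_adj xz); lia.
apply/eqP; rewrite eqn_leq (leq_trans (dist_set_le x Ww)) //=.
have h_le u : u \in W -> h x <= dist x u.
  by move=> Wu; have := lipschitz_dist x u; rewrite (hW Wu).
apply: dist_set_geq => //.
exact: leq_trans (h_le w Ww) (ltnW (dist_lt_card _ _)).
Qed.

(** The higher vertex has a geodesic to [W] through the lower one. *)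
Lemma lipschitz_strongly_resolves x y :
  x \in X -> y \in X -> x != y -> strongly_resolves W x y.
Proof.
move=> Xx Xy ne_xy; rewrite /strongly_resolves ne_xy.
have notW u : u \in X -> u \notin W.
  by move=> /hX; apply: contraL => /hW->.
rewrite !notW // !lipschitz_dist_set //=.
case/orP: (leq_total (h y) (h x)) => /lipschitz_dist_eq.
  by move=> ->; rewrite ?eqxx.
by move=> ->; rewrite ?eqxx ?orbT.
Qed.

End Lipschitz.
End Distance.

(** * Cycles rule out fewer than three classes *)

Section LowerBound.
Variable G : graph.
Implicit Types (x y : G) (A B : {set G}) (P : {set {set G}}).

Lemma graph_cycle_rot (c : seq G) n :
  graph_cycle (rot n c) = graph_cycle c.
Proof. by rewrite /graph_cycle /ucycleb rot_cycle rot_uniq size_rot. Qed.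

Lemma graph_cycle_two_adj (c : seq G) x : graph_cycle c -> x \in c ->
  exists y z, [/\ y \in c, z \in c, y != z, adj x y & adj x z].
Proof.
move=> cG xc; have [i p def_p] := rot_to xc.
have := graph_cycle_rot c i; rewrite {}cG def_p.
have eq_c : x :: p =i c by move=> u; rewrite -def_p mem_rot.
case: p {def_p} eq_c => [|y [|w p]] eq_c;
  rewrite /graph_cycle /ucycleb ?andbF //.
rewrite /= rcons_path => /andP[/andP[/and3P[xy _ /andP[_ zx]] Uc] _].
exists y, (last w p); split; rewrite ?(adj_sym x (last w p)) //.
- by rewrite -eq_c !inE eqxx orbT.
- by rewrite -eq_c 2!in_cons mem_last !orbT.
- case/and3P: Uc => _ yp _; apply: contraNneq yp => ->; exact: mem_last.
Qed.

Lemma two_blocks_labelling P :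
  strong_resolving_partition P -> #|P| = 2 ->
  exists2 f : G -> nat, injective f &
    forall x y, adj x y -> f x = (f y).+1 \/ f y = (f x).+1.
Proof.
move=> /andP[partP resP] /eqP/cards2P[A [B [neAB defP]]].
have [/eqP coverP trivP _] := and3P partP.
have PA : A \in P by rewrite defP !inE eqxx.
have PB : B \in P by rewrite defP !inE eqxx orbT.
have dAB x : x \in A -> x \notin B.
  by move=> xA; move/trivIsetP/(_ A B PA PB neAB)/disjointFr: trivP => ->.
have notA x : x \notin A -> x \in B.
  have: x \in cover P by rewrite coverP inE.
  case/bigcupP=> D; rewrite defP !inE => /orP[]/eqP->; last by [].
  by move=> ->.
(* A set resolving two vertices contains neither of them, so here it is the other class. *)
have res x y (D E : {set G}) : D \in P -> x \in D -> y \in D -> x != y ->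
    (forall F, F \in P -> F != D -> F = E) ->
  dist_set x E = dist x y + dist_set y E \/
  dist_set y E = dist y x + dist_set x E.
  move=> PD Dx Dy ne_xy defE.
  move/forall_inP/(_ D PD)/forall_inP/(_ x Dx)/forall_inP/(_ y Dy): resP.
  move/implyP/(_ ne_xy)/exists_inP=> [W PW /and4P[_ xW _ /orP resW]].
  have <- : W = E by apply: defE => //; apply: contraNneq xW => ->.
  by case: resW => /eqP; [left | right].
have otherA F : F \in P -> F != A -> F = B.
  by rewrite defP !inE => /orP[]/eqP-> //; rewrite eqxx.
have otherB F : F \in P -> F != B -> F = A.
  by rewrite defP !inE => /orP[]/eqP-> //; rewrite eqxx.
(* Distances to the opposite class lie between 1 and [#|G|], so [A] gets labels above [#|G|] and [B]
   positive labels up to [#|G|]. An edge between the classes, with both distances 1, gets [#|G|.+1]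
   and [#|G|]. *)
pose f x := if x \in A then #|G| + dist_set x B else #|G|.+1 - dist_set x A.
have ne_dist x y : x != y -> 0 < dist x y by rewrite lt0n dist_eq0.
exists f => [x y | x y xy]; rewrite /f.
  have lex := dist_set_leq_card x A; have ley := dist_set_leq_card y A.
  case: ifPn => Ax; case: ifPn => Ay.
  - case: (eqVneq x y) => // ne_xy.
    have := ne_dist _ _ ne_xy; have : 0 < dist y x by rewrite ne_dist 1?eq_sym.
    by have := res x y A B PA Ax Ay ne_xy otherA; lia.
  - by have := dist_set_gt0 (dAB x Ax); have := dist_set_gt0 Ay; lia.
  - by have := dist_set_gt0 (dAB y Ay); have := dist_set_gt0 Ax; lia.
  - case: (eqVneq x y) => // ne_xy.
    have := ne_dist _ _ ne_xy; have : 0 < dist y x by rewrite ne_dist 1?eq_sym.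
    by have := res x y B A PB (notA x Ax) (notA y Ay) ne_xy otherB; lia.
have ne_xy : x != y by apply: contraTneq xy => ->; rewrite adj_irrefl.
have yx : adj y x by rewrite adj_sym.
have dxy := dist_adj xy; have dyx := dist_adj yx.
have lex := dist_set_leq_card x A; have ley := dist_set_leq_card y A.
case: ifPn => Ax; case: ifPn => Ay.
- by have := res x y A B PA Ax Ay ne_xy otherA; lia.
- have := dist_set_gt0 (dAB x Ax); have := dist_set_gt0 Ay.
  by have := dist_set_le x (notA y Ay); have := dist_set_le y Ax; lia.
- have := dist_set_gt0 (dAB y Ay); have := dist_set_gt0 Ax.
  by have := dist_set_le y (notA x Ax); have := dist_set_le x Ay; lia.
- by have := res x y B A PB (notA x Ax) (notA y Ay) ne_xy otherB; lia.
Qed.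

Lemma strong_resolving_partition_cycle P (c : seq G) :
  graph_cycle c -> strong_resolving_partition P -> 2 < #|P|.
Proof.
move=> cG resP; have [u uc] : exists u, u \in c.
  by case: c cG => [|u c]; rewrite ?andbF // => _; exists u; rewrite mem_head.
rewrite ltnNge; apply/negP => leP2.
have [P0 | P1 | P2] : [\/ #|P| = 0, #|P| = 1 | #|P| = 2].
- by case: #|P| leP2 => [|[|[|]]] // _; [apply: Or31|apply: Or32|apply: Or33].
- have [/and3P[/eqP coverP _ _] _] := andP resP.
  have: u \in cover P by rewrite coverP inE.
  by rewrite (cards0_eq P0) /cover big_set0 inE.
(* A single class contains every vertex and so resolves no pair. *)
- have [/and3P[/eqP coverP _ _] /forall_inP resolve] := andP resP.
  have /cards1P[A defP] : #|P| == 1 by rewrite P1.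
  have inA x : x \in A.
    have: x \in cover P by rewrite coverP inE.
    by rewrite defP /cover big_set1.
  have [y [z [_ _ ne_yz _ _]]] := graph_cycle_two_adj cG uc.
  have PA : A \in P by rewrite defP set11.
  move: (resolve A PA) => /forall_inP/(_ y (inA y))/forall_inP/(_ z (inA z)).
  rewrite ne_yz => /exists_inP[W]; rewrite defP => /set1P->.
  by case/and4P=> _; rewrite inA.
have [f f_inj f_adj] := two_blocks_labelling resP P2.
case: (@arg_maxnP _ u (mem c) f uc) => x xc maxx.
have [y [z [yc zc ne_yz xy xz]]] := graph_cycle_two_adj cG xc.
case/eqP: ne_yz; apply: f_inj.
have := maxx y yc; have := maxx z zc.
have := f_adj _ _ xy; have := f_adj _ _ xz.
by rewrite /=; lia.
Qed.

End LowerBound.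

(** * Bridges and distances from the end-vertex in a unicyclic graph *)

Section Unicyclic.
Variables (G : graph) (C : seq G).
Hypothesis C_cycle : graph_cycle C.
Hypothesis C_unique : forall c, graph_cycle c -> cycle_edges c = cycle_edges C.
Implicit Types (x y z u w : G).

(** Comparing edges as unordered pairs matches [cycle_edges] and keeps the relation symmetric. *)
Definition adj_minus x y : rel G :=
  [rel u w | adj u w && ([set u; w] != [set x; y])].

Lemma connect_adj_minus_sym x y : connect_sym (adj_minus x y).
Proof.
by apply: sym_connect_sym => u w; rewrite /adj_minus /= adj_sym setUC.
Qed.

(** A simple path from [x] to [y] without the edge would close up with it to a cycle, which by
    uniqueness has the edges of [C]. *)
Lemma bridge x y : adj x y -> [set x; y] \notin cycle_edges C ->
  ~~ connect (adj_minus x y) x y.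
Proof.
move=> xy; apply: contra => /connectP[p0 xp0 def_y].
case/shortenP: xp0 def_y => p xp Up _ def_y.
have xpG : path (@adj G) x p.
  by apply: sub_path xp => u w /andP[].
case/lastP: p xp Up def_y xpG => [|q y'] xp Up.
  by move=> def_y; rewrite def_y /= adj_irrefl in xy.
rewrite last_rcons => def_y xpG; subst y'.
have cG : graph_cycle (x :: rcons q y).
  rewrite /graph_cycle /ucycleb Up /= rcons_path xpG last_rcons adj_sym xy /=.
  (* For empty [q] the path would be the deleted edge; otherwise the cycle has at least three
     vertices. *)
  case: q xp {Up xpG} => [|w q]; last by rewrite size_rcons.
  by rewrite /= /adj_minus /= eqxx andbF.
rewrite -(C_unique cG); apply/imsetP; exists y.
  by rewrite inE mem_rcons mem_head orbT.
have ne_yx : x != y by apply: contraTneq xy => ->; rewrite adj_irrefl.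
(* [y] ends the listing, so [next] falls back on the first vertex [x]. *)
rewrite next_nth inE mem_rcons mem_head orbT /= (negbTE ne_yx) setUC.
have yq : y \notin q by move: Up; rewrite /= rcons_uniq => /and3P[].
rewrite -cats1 index_cat (negbTE yq) /= eqxx addn0 nth_default //.
by rewrite size_cat addn1.
Qed.

Lemma connect_cycle_minus x y : [set x; y] \notin cycle_edges C ->
  {in C &, forall u w, connect (adj_minus x y) u w}.
Proof.
move=> xyC u w uC wC.
have Cc : cycle (adj_minus x y) C.
  case/andP: C_cycle => /andP[cC UC] _; apply: cycle_from_next => // z zC.
  rewrite /adj_minus /= (next_cycle cC zC); apply: contraNneq xyC => <-.
  by apply/imsetP; exists z.
exact: connect_cycle Cc _ _ uC wC.
Qed.

Lemma cycle_edge_mem x y : [set x; y] \in cycle_edges C -> x \in C.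
Proof.
case/imsetP=> z zC eq_xy; have: x \in [set x; y] by rewrite !inE eqxx.
by rewrite eq_xy !inE => /orP[]/eqP->; rewrite ?mem_next.
Qed.

(** A chord would be an edge off the cycle, hence a bridge, yet its ends are joined along [C]. *)
Lemma adj_cycle_next x y : x \in C -> y \in C -> adj x y ->
  y = next C x \/ x = next C y.
Proof.
move=> xC yC xy.
have [/imsetP[z zC eq_xy] | xyE] := boolP ([set x; y] \in cycle_edges C).
  have ne_xy : x != y by apply: contraTneq xy => ->; rewrite adj_irrefl.
  have: (x \in [set x; y]) && (y \in [set x; y]) by rewrite !inE !eqxx orbT.
  rewrite eq_xy !inE => /andP[/orP[]/eqP ex /orP[]/eqP ey]; subst; auto.
  - by rewrite eqxx in ne_xy.
  - by rewrite eqxx in ne_xy.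
by have := bridge xy xyE; rewrite connect_cycle_minus.
Qed.

Variable v : G.
Hypothesis v_end : end_vertices G = [set v].
Let D := dist v.

(** A geodesic from [w] to [v] strictly decreases [D], so it never meets [z] and uses no edge at
    [z]. *)
Lemma connect_below z u w : D w <= D z -> w != z ->
  connect (adj_minus z u) w v.
Proof.
move: {2}(D w) (erefl (D w)) => n.
elim: n w => [|n IHn] w Dw le_wz ne_wz.
  by move/eqP: Dw; rewrite dist_eq0 => /eqP->.
have [|p wp Dp] := @dist_parent G v w; first by rewrite -/(D w) Dw.
rewrite -/(D p) -/(D w) in Dp.
have ne_pz : p != z by apply: contraTneq le_wz => <-; lia.
apply: connect_trans (IHn p _ _ ne_pz); [|lia|lia].
apply: connect1; rewrite /adj_minus /= wp; apply/eqP=> /setP/(_ z).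
by rewrite !inE eqxx ![z == _]eq_sym (negbTE ne_wz) (negbTE ne_pz).
Qed.

(** For [z] other than [v] there is a neighbour [w] besides the parent [u]. Were [w] no farther from
    [v] than [z], the route from [z] through [w] and [v] to [u] would bypass the bridge [zu]. *)
Lemma off_cycle_step z : z \notin C -> exists2 y, adj z y & D y = (D z).+1.
Proof.
move=> zC; have [<- | ne_vz] := eqVneq v z.
  have: v \in end_vertices G by rewrite v_end set11.
  rewrite inE => /cards1P[y /setP/(_ y)]; rewrite !inE eqxx => vy.
  by exists y; rewrite // /D (dist_adj vy) dist_self.
have [|u zu Du] := @dist_parent G v z; first by rewrite lt0n dist_eq0.
rewrite -/(D u) -/(D z) in Du.
have /subsetPn[w] : ~~ ([set y | adj z y] \subset [set u]).
  have: z \notin end_vertices G by rewrite v_end inE eq_sym.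
  apply: contra; rewrite subset1 !inE => /orP[/eqP-> | /eqP/setP/(_ u)].
    by rewrite cards1.
  by rewrite !inE zu.
rewrite !inE => zw ne_wu; exists w => //.
apply/eqP; rewrite eqn_leq (dist_adjr v zw) ltnNge /=; apply/negP=> le_wz.
have ne_wz : w != z by apply: contraTneq zw => ->; rewrite adj_irrefl.
have ne_uz : u != z by apply: contraTneq zu => ->; rewrite adj_irrefl.
have/negP[] : ~~ connect (adj_minus z u) z u.
  by apply: bridge => //; apply: contra zC; apply: cycle_edge_mem.
apply: (@connect_trans _ _ w).
  apply: connect1; rewrite /adj_minus /= zw; apply/eqP=> /setP/(_ w).
  by rewrite !inE eqxx (negbTE ne_wu) (negbTE ne_wz).
apply: (@connect_trans _ _ v); first exact: connect_below.
by rewrite connect_adj_minus_sym connect_below // -Du leqnSn.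
Qed.

(** Climbing by [off_cycle_step] must end on the cycle, because distances stay below [#|G|]; every
    vertex met has distance at least [D z], so [u] is not among them. *)
Lemma connect_above z u w : D u < D z -> D z <= D w ->
  exists2 c, c \in C & connect (adj_minus z u) w c.
Proof.
move=> lt_uz; move: {2}(#|G| - D w) (leqnn (#|G| - D w)) => n.
elim: n w => [|n IHn] w le_n le_zw.
  by have := dist_lt_card v w; rewrite -/(D w); lia.
have [wC | wC] := boolP (w \in C); first by exists w.
have [y wy Dy] := off_cycle_step wC.
have [||c cC yc] := IHn y; [lia|lia|].
exists c => //; apply: connect_trans yc; apply: connect1.
rewrite /adj_minus /= wy.
apply/eqP=> /setP/(_ u); rewrite !inE eqxx orbT.
by case/orP=> /eqP eq_u; move: lt_uz; rewrite eq_u; lia.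
Qed.

(** For [w != z], the bridge from [z] to its parent [u] would be bypassed: from [z] up to the cycle,
    along it, back to [w], down to [v] and on to [u]. The case [w \in C] serves to place the cycle
    farther from [v] than [z]. *)
Lemma off_cycle_dist_uniq z w : z \notin C -> D w <= D z ->
  (w \in C) || (D w == D z) -> w = z.
Proof.
move=> zC le_wz Cw; apply/eqP/negPn/negP => ne_wz.
have Dz0 : 0 < D z.
  rewrite lt0n; apply: contraNneq ne_wz => Dz; move: le_wz; rewrite Dz leqn0.
  by move/eqP: Dz; rewrite /D !dist_eq0 => /eqP<- /eqP<-.
have [u zu Du] := dist_parent Dz0; rewrite -/(D u) -/(D z) in Du.
have ne_uz : u != z by apply: contraTneq zu => ->; rewrite adj_irrefl.
have zuC : [set z; u] \notin cycle_edges C.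
  by apply: contra zC; apply: cycle_edge_mem.
have/negP[] := bridge zu zuC.
have lt_uz : D u < D z by lia.
have [c cC zc] := connect_above lt_uz (leqnn _).
have [c' cC' wc'] : exists2 c, c \in C & connect (adj_minus z u) w c.
  case/orP: Cw => [wC | /eqP Dw]; first by exists w.
  by apply: connect_above; rewrite ?Dw.
apply: connect_trans zc _.
apply: connect_trans (connect_cycle_minus zuC cC cC') _.
apply: (@connect_trans _ _ w); first by rewrite connect_adj_minus_sym.
apply: (@connect_trans _ _ v); first exact: connect_below.
by rewrite connect_adj_minus_sym connect_below // ltnW.
Qed.

Lemma off_cycle_dist_lt z c : z \notin C -> c \in C -> D z < D c.
Proof.
move=> zC cC; rewrite ltnNge; apply/negP => le_cz; move: (zC).
by rewrite -(off_cycle_dist_uniq zC le_cz) cC.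
Qed.

Lemma attachment_uniq x y x' y' : adj x y -> adj x' y' ->
  x \notin C -> y \in C -> x' \notin C -> y' \in C -> y = y'.
Proof.
move=> xy xy' xC yC xC' yC'.
have eq_x : x = x'.
  apply: off_cycle_dist_uniq => //.
  - have := off_cycle_dist_lt xC yC'; have := dist_adjr v xy'; rewrite -/D; lia.
  (* The off-cycle end of each edge is closer to [v] than the cycle end of the other, and adjacent
     distances differ by at most one. *)
  - apply/orP; right.
    have := off_cycle_dist_lt xC yC'; have := dist_adjr v xy'.
    have := off_cycle_dist_lt xC' yC; have := dist_adjr v xy.
    by rewrite -/D; lia.
subst x'; apply/eqP/negPn/negP => ne_yy'.
(* With [x] common to both edges, the bridge [xy] would be bypassed through [y'] and the cycle. *)
have xyC : [set x; y] \notin cycle_edges C.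
  by apply: contra xC; apply: cycle_edge_mem.
have/negP[] := bridge xy xyC.
apply: connect_trans (connect_cycle_minus xyC yC' yC); apply: connect1.
rewrite /adj_minus /= xy'; apply/eqP=> /setP/(_ y).
rewrite !inE eqxx orbT (negbTE ne_yy').
by rewrite orbF => /eqP eq_y; rewrite -eq_y yC in xC.
Qed.

End Unicyclic.

(** * A strong resolving partition into three classes *)

Section UpperBound.
Variables (G : graph) (c0 : G) (p : seq G) (v : G).
Let C := c0 :: p.
Let D := dist v.
Implicit Types (x y : G).
Hypothesis C_cycle : graph_cycle C.
Hypothesis C_unique : forall c, graph_cycle c -> cycle_edges c = cycle_edges C.
Hypothesis v_end : end_vertices G = [set v].
Hypothesis attach_c0 :
  forall x y, adj x y -> x \notin C -> y \in C -> y = c0.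

(* [pos x = t] encodes that [x] lies off the cycle. *)
Let pos x := index x C.
Let t := size C.

Lemma pos_next x : x \in C ->
  pos (next C x) = if (pos x).+1 == t then 0 else (pos x).+1.
Proof.
move=> xC; have [/andP[_ UC] _] := andP C_cycle.
rewrite /pos /t next_nth xC -[X in index X _]/(nth c0 C (index x C).+1).
have := xC; rewrite -index_mem; case: eqP => [-> _ | ne lt_x].
  by rewrite nth_default //= eqxx.
by rewrite index_uniq // ltn_neqAle lt_x andbT; apply/eqP.
Qed.

Lemma pos_inj x y : x \in C -> pos x = pos y -> x = y.
Proof.
move=> xC eq_pos; apply: (index_inj c0 xC) => //.
by rewrite -index_mem -[index y C]eq_pos index_mem.
Qed.

Lemma in_cycle_pos x : (x \in C) = (pos x < t).
Proof. by rewrite index_mem. Qed.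

Lemma pos_le x : pos x <= t.
Proof. exact: index_size. Qed.

Lemma pos0 x : pos x = 0 -> x = c0.
Proof. by rewrite /pos /=; case: eqP. Qed.

Lemma pos_c0 : pos c0 = 0.
Proof. by rewrite /pos /= eqxx. Qed.

Lemma cycle_pred x : x \in C -> 0 < pos x ->
  exists2 y, adj x y & (pos y).+1 = pos x.
Proof.
move=> xC pos_x; have [/andP[cC UC] _] := andP C_cycle.
have lt_x : pos x < t by rewrite -in_cycle_pos.
pose y := nth c0 C (pos x).-1.
have pos_y : pos y = (pos x).-1.
  by rewrite /pos index_uniq // -/(pos x) -/t; lia.
have yC : y \in C by rewrite in_cycle_pos pos_y; lia.
exists y; last by rewrite pos_y; lia.
have -> : x = next C y.
  by apply: pos_inj => //; rewrite pos_next // pos_y; case: eqP; lia.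
by rewrite adj_sym next_cycle.
Qed.

Definition tail : {set G} := [set x | (pos x == 0) || (pos x == t)].
(** Cutting the cycle opposite [c0] makes the distance to [c0] injective on each arc; for even [t]
    the antipodal vertex falls into [arc1]. *)
Definition arc1 : {set G} := [set x | (0 < pos x) && ((pos x).*2 <= t)].
Definition arc2 : {set G} := [set x | (t < (pos x).*2) && (pos x < t)].

Lemma cycle_size : 2 < t.
Proof. by case/andP: C_cycle. Qed.

(** The distance to [c0] along the cycle, and 0 off the cycle, where [pos x = t]. *)
Definition cycle_height x := minn (pos x) (t - pos x).

(** In the absence of chords, an edge within the cycle shifts the position by one modulo [t]; an
    edge leaving the cycle does so at [c0], where both heights are 0. *)
Lemma cycle_height_adj x y :
  adj x y -> cycle_height x <= (cycle_height y).+1.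
Proof.
have t_gt2 := cycle_size.
have off z : z \notin C -> cycle_height z = 0.
  by rewrite in_cycle_pos /cycle_height; have := pos_le z; lia.
have h0 : cycle_height c0 = 0 by rewrite /cycle_height pos_c0 min0n.
move=> xy; have yx : adj y x by rewrite adj_sym.
have [xC | /off->//] := boolP (x \in C).
have [yC | yC] := boolP (y \in C); last by rewrite (attach_c0 yx) ?h0.
have := xC; have := yC; rewrite !in_cycle_pos /cycle_height.
case: (adj_cycle_next C_cycle C_unique xC yC xy) => ->.
  by rewrite pos_next //; case: eqP; lia.
by rewrite pos_next //; case: eqP; lia.
Qed.

Lemma cycle_height_tail x : x \in tail -> cycle_height x = 0.
Proof. by rewrite inE /cycle_height; lia. Qed.

Lemma arc1_resolved :
  {in arc1 &, forall x y, x != y -> strongly_resolves tail x y}.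
Proof.
have t_gt2 := cycle_size.
move=> x y x1 y1; apply: (lipschitz_strongly_resolves (h := cycle_height))
  x1 y1.
- exact: cycle_height_adj.
- exact: cycle_height_tail.
- by move=> z; rewrite inE /cycle_height; lia.
- move=> z w; rewrite !inE /cycle_height => z1 w1 eq_h.
  by apply: pos_inj; rewrite ?in_cycle_pos; lia.
move=> z; rewrite inE => z1; have [||w zw pos_w] := @cycle_pred z.
- by rewrite in_cycle_pos; lia.
- by lia.
by exists w => //; rewrite !inE /cycle_height; lia.
Qed.

Lemma arc2_resolved :
  {in arc2 &, forall x y, x != y -> strongly_resolves tail x y}.
Proof.
have t_gt2 := cycle_size; have [/andP[cC _] _] := andP C_cycle.
move=> x y x1 y1; apply: (lipschitz_strongly_resolves (h := cycle_height))
  x1 y1.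
- exact: cycle_height_adj.
- exact: cycle_height_tail.
- by move=> z; rewrite inE /cycle_height; lia.
- move=> z w; rewrite !inE /cycle_height => z1 w1 eq_h.
  by apply: pos_inj; rewrite ?in_cycle_pos; lia.
move=> z; rewrite inE => z1.
have zC : z \in C by rewrite in_cycle_pos; lia.
(* On this arc the height is [t - pos z], so the lower neighbour is the successor. *)
exists (next C z); first exact: next_cycle.
by rewrite !inE /cycle_height pos_next //; case: eqP; lia.
Qed.

(** On [tail] this will be the distance to [arc1]; the successor gives height 1 to [c0], the tail
    vertex farthest from [v]. *)
Definition tail_height x := if x \in tail then (D c0).+1 - D x else 0.

Lemma tail_off_cycle x : x \in tail -> x != c0 -> x \notin C.
Proof.
rewrite inE in_cycle_pos => /orP[/eqP/pos0-> | /eqP->]; first by rewrite eqxx.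
by rewrite ltnn.
Qed.

Lemma c0_tail : c0 \in tail.
Proof. by rewrite inE pos_c0. Qed.

Lemma off_cycle_tail x : x \notin C -> x \in tail.
Proof. by rewrite in_cycle_pos inE; have := pos_le x; lia. Qed.

Lemma tail_dist_le x : x \in tail -> D x <= D c0 ?= iff (x == c0).
Proof.
move=> xA; have [-> | ne_x] := eqVneq x c0; first exact/leqif_refl.
have xC := tail_off_cycle xA ne_x.
have := off_cycle_dist_lt C_cycle C_unique v_end xC (mem_head c0 p).
by rewrite -/D; split; [apply: ltnW | apply/eqP; lia].
Qed.

Lemma tail_resolved :
  {in tail &, forall x y, x != y -> strongly_resolves arc1 x y}.
Proof.
have t_gt2 := cycle_size; have [/andP[cC _] _] := andP C_cycle.
move=> x y xA yA; apply: (lipschitz_strongly_resolves (h := tail_height)) xA yA.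
- move=> z w zw; rewrite /tail_height; case: ifPn => // zA.
  have := dist_adjr v zw; rewrite -/D => le_D.
  case: ifPn => wA; first by lia.
  have wC : w \in C by apply: contraR wA; apply: off_cycle_tail.
  (* Only [c0], of height 1, has neighbours outside [tail]. *)
  have [-> | ne_z] := eqVneq z c0; first by lia.
  have zC := tail_off_cycle zA ne_z.
  by rewrite (attach_c0 zw zC wC) c0_tail in wA.
- by move=> z; rewrite /tail_height !inE; case: ifP; lia.
- by move=> z zA; rewrite /tail_height zA; have := tail_dist_le zA => -[]; lia.
- move=> z w zA wA; rewrite /tail_height zA wA => eq_h.
  have [lez eqz] := tail_dist_le zA; have [lew eqw] := tail_dist_le wA.
  have eqD : D z = D w by lia.
  have [ez | ne_z] := eqVneq z c0.
    by rewrite ez; apply/esym/eqP; rewrite -eqw -eqD eqz ez.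
  apply/esym; apply: (off_cycle_dist_uniq C_cycle C_unique v_end).
  - exact: tail_off_cycle.
  - by rewrite -/D eqD.
  - by rewrite -/D eqD eqxx orbT.
move=> z zA.
have [ez | ne_z] := eqVneq z c0.
  subst z; exists (next C c0); first by rewrite next_cycle ?mem_head.
  rewrite /tail_height c0_tail !inE pos_next ?mem_head // pos_c0.
  have t_ne1 : (1 == t) = false by lia.
  by rewrite !t_ne1 subSnn eqxx andbT; exact: ltnW t_gt2.
have zC := tail_off_cycle zA ne_z.
(* Moving away from [v] lowers the height, and an arrival on the cycle is at [c0], still in
   [tail]. *)
have [w zw Dw] := off_cycle_step C_cycle C_unique v_end zC; rewrite -/D in Dw.
have wA : w \in tail.
  have [wC | /off_cycle_tail//] := boolP (w \in C).
  by rewrite (attach_c0 zw zC wC) c0_tail.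
exists w => //; rewrite inE wA /tail_height wA zA.
by have [] := tail_dist_le wA; have [] := tail_dist_le zA; lia.
Qed.

Lemma tail_arcs_partition :
  exists2 P : {set {set G}}, strong_resolving_partition P & #|P| = 3.
Proof.
have t_gt2 := cycle_size; have [/andP[_ UC] _] := andP C_cycle.
have in_arc1 : nth c0 C 1 \in arc1.
  have lt1t : 1 < t by lia.
  by rewrite inE /pos index_uniq //; apply/andP.
have in_arc2 : nth c0 C t.-1 \in arc2.
  by rewrite inE /pos index_uniq //; lia.
have d01 : [disjoint tail & arc1].
  by rewrite disjoint_subset; apply/subsetP=> x; rewrite !inE; lia.
have d02 : [disjoint tail & arc2].
  by rewrite disjoint_subset; apply/subsetP=> x; rewrite !inE; lia.
have d12 : [disjoint arc1 & arc2].
  by rewrite disjoint_subset; apply/subsetP=> x; rewrite !inE; lia.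
have ne01 : tail != arc1.
  by apply: contraTneq (in_arc1) => <-; rewrite (disjointFl d01 in_arc1).
have ne02 : tail != arc2.
  by apply: contraTneq (in_arc2) => <-; rewrite (disjointFl d02 in_arc2).
have ne12 : arc1 != arc2.
  by apply: contraTneq (in_arc2) => <-; rewrite (disjointFl d12 in_arc2).
exists [set tail; arc1; arc2]; last first.
  rewrite setUC cardsU1 cards2 !inE negb_or ![arc2 == _]eq_sym.
  by rewrite ne01 ne02 ne12.
apply/andP; split.
  apply/and3P; split.
  - apply/eqP/setP=> x; rewrite inE; apply/bigcupP.
    have [x0 | x0] := boolP (x \in tail).
      by exists tail; rewrite // !inE eqxx.
    have [x1 | x1] := boolP (x \in arc1).
      by exists arc1; rewrite // !inE eqxx orbT.
    exists arc2; first by rewrite !inE eqxx orbT.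
    by move: x0 x1; rewrite !inE; have := pos_le x; lia.
  - apply/trivIsetP=> A B; rewrite !inE -!orbA.
    by move=> /or3P[]/eqP-> /or3P[]/eqP->; rewrite ?eqxx // disjoint_sym.
  - rewrite !inE -!orbA; apply/or3P=> -[]/eqP/setP.
    + by move=> /(_ c0); rewrite c0_tail inE.
    + by move=> /(_ (nth c0 C 1)); rewrite in_arc1 inE.
    + by move=> /(_ (nth c0 C t.-1)); rewrite in_arc2 inE.
apply/forall_inP=> A PA; apply/forall_inP=> x Ax; apply/forall_inP=> y Ay.
apply/implyP=> ne_xy; apply/exists_inP.
move: PA; rewrite !inE -orbA => /or3P[]/eqP eqA; subst A.
- by exists arc1; rewrite ?inE ?eqxx ?orbT // tail_resolved.
- by exists tail; rewrite ?inE ?eqxx ?orbT // arc1_resolved.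
- by exists tail; rewrite ?inE ?eqxx ?orbT // arc2_resolved.
Qed.

End UpperBound.

Theorem theorem25 (G : graph) (G_unicyclic : unicyclic G)
    (G_not_cycle : ~ is_cycle_graph G)
    (t : nat) (C : seq G) (C_cycle : graph_cycle C) (size_C : size C = t)
    (t_ge3 : 3 <= t) (one_end : #|end_vertices G| = 1) :
  pds G = 3.
Proof.
have [c cG c_uniq] := G_unicyclic.
have /cards1P[v v_end] : #|end_vertices G| == 1 by rewrite one_end.
have [c0 c0c attach] : exists2 c0, c0 \in c &
    forall x y, adj x y -> x \notin c -> y \in c -> y = c0.
  pose attached y := (y \in c) && [exists x, adj x y && (x \notin c)].
  have [y0 /andP[y0c /existsP[x0 /andP[xy0 x0c]]] | none] := pickP attached.
    exists y0 => // x y xy xc yc.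
    exact: (attachment_uniq cG c_uniq v_end xy xy0).
  (* If no edge leaves the cycle, the condition is vacuous and any cycle vertex will do. *)
  have [x xc] : exists x, x \in c.
    case: c cG {c_uniq none attached} => [|x c]; rewrite ?andbF // => _.
    by exists x; rewrite mem_head.
  exists x => // u y uy uc yc; have/negP[] := negbT (none y).
  by rewrite /attached yc; apply/existsP; exists u; rewrite uy.
have [i p def_p] := rot_to c0c.
have pG : graph_cycle (c0 :: p) by rewrite -def_p graph_cycle_rot.
have p_uniq c' : graph_cycle c' -> cycle_edges c' = cycle_edges (c0 :: p).
  by move=> /c_uniq->; rewrite (c_uniq _ pG).
have p_attach x y : adj x y -> x \notin c0 :: p -> y \in c0 :: p -> y = c0.
  by rewrite -def_p !mem_rot; apply: attach.
have [P resP cardP] := tail_arcs_partition pG p_uniq v_end p_attach.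
rewrite /pds; case: ex_minnP => n /existsP[Q /andP[resQ /eqP<-]] minQ.
apply/eqP; rewrite eqn_leq (strong_resolving_partition_cycle cG resQ) andbT.
by apply: minQ; apply/existsP; exists P; rewrite resP cardP eqxx.
Qed.
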